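(* Let $(M,g,S)$ be a four-dimensional Riemannian manifold with a skew-circulant structure $S$ (as defined in the context) whose curvature tensor satisfies $R(Sx,Sy,Sz,Su)=R(x,y,z,u)$ for all $x,y,z,u$. Let $p\in M$. If a vector $x\in T_pM$ induces an $S$-basis of $T_pM$, then the Ricci curvatures in the direction of the basis vectors are $$r(x)=r(Sx)=r(S^2x)=r(S^3x)=\frac{\tau}{4}+\frac{\tau^{*}}{2}\cos\varphi,$$ where $\varphi=\angle(x,Sx)$.
   Context: Throughout, $(M,g,S)$ denotes a $4$-dimensional differentiable manifold $M$ with a Riemannian metric $g$ and a tensor $S$ of type $(1,1)$ whose components with respect to the local basis $\{e_1,e_2,e_3,e_4\}$ form the right skew-circulant matrix $$(S_i^j)=\begin{pmatrix}0&1&0&0\\ 0&0&1&0\\ 0&0&0&1\\ -1&0&0&0\end{pmatrix},\qquad Se_i=S_i^j e_j,$$ so $S^4=-\mathrm{id}$. $S$ is assumed to be an isometry: $g(Sx,Sy)=g(x,y)$. Consequently the components $g_{ij}=g(e_i,e_j)$ are $$(g_{ij})=\begin{pmatrix} A & B & 0 & -B \\ B & A & B & 0 \\ 0 & B & A & B \\ -B & 0 & B & A \end{pmatrix}$$ with smooth functions $A,B$, where it is supposed that $A>\sqrt2\,B>0$ (so $g$ is positive definite). Here $x,y,z,u$ are arbitrary smooth vector fields on $M$ or vectors in a tangent space $T_pM$. The associated metric $\tilde g$ (indefinite, nondegenerate) is $\tilde g(x,y)=g(x,Sy)+g(Sx,y)$. $\nabla$ is the Levi-Civita connection of $g$, $R(x,y)z=\nabla_x\nabla_y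 z-\nabla_y\nabla_x z-\nabla_{[x,y]}z$, and $R(x,y,z,u)=g(R(x,y)z,u)$. The Ricci tensor is $\rho(y,z)=g^{ij}R(e_i,y,z,e_j)$, the scalar curvature is $\tau=g^{ij}\rho(e_i,e_j)$ and its associated quantity is $\tau^{*}=\tilde g^{ij}\rho(e_i,e_j)$, where $(g^{ij})$ and $(\tilde g^{ij})$ are the inverse matrices of $(g_{ij})$ and $(\tilde g_{ij})=(\tilde g(e_i,e_j))$, and summation over repeated indices is understood. The Ricci curvature in the direction of a nonzero vector $x$ is $r(x)=\rho(x,x)/g(x,x)$. A vector $x\in T_pM$ induces an $S$-basis of $T_pM$ if $\{S^3x,S^2x,Sx,x\}$ is a basis of $T_pM$. Angles are measured with respect to $g$. *)

(* Defs.v *)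
From HB Require Import structures.
From mathcomp Require Import all_boot all_order all_algebra.
From mathcomp Require Import all_classical all_reals all_analysis.

Set Implicit Arguments.
Unset Strict Implicit.
Unset Printing Implicit Defensive.

Import Order.TTheory GRing.Theory Num.Theory.
Import numFieldNormedType.Exports.

Local Open Scope classical_set_scope.
Local Open Scope ring_scope.

(* [Ck k V f]: f is of class C^k on the open set V. *)
Fixpoint Ck (R : realType) (k : nat) (V : set 'rV[R]_4) (f : 'rV[R]_4 -> R)
    {struct k} : Prop :=
  (forall x, V x -> {for x, continuous f}) /\
  if k is l.+1 then
    forall i : 'I_4,
      (forall x, V x -> derivable f x (delta_mx 0 i)) /\
      Ck l V (fun x => 'D_(delta_mx 0 i) f x)
  else True.

Definition Cinfty (R : realType) (V : set 'rV[R]_4) (f : 'rV[R]_4 -> R) : Prop :=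
  forall k, Ck k V f.

(* [chart_inv] is only meaningful on the image of [chart_dom]. *)
Record chart (R : realType) (M : Type) := Chart {
  chart_dom : set M;
  chart_map : M -> 'rV[R]_4;
  chart_inv : 'rV[R]_4 -> M
}.

Definition chart_image (R : realType) (M : Type) (c : chart R M) (U : set M) :
  set 'rV[R]_4 := chart_map c @` (U `&` chart_dom c).

Record is_chart (R : realType) (M : topologicalType) (c : chart R M) : Prop := {
  chart_dom_open : open (chart_dom c);
  chart_image_open : open (chart_image c setT);
  chart_mapK : forall q, chart_dom c q -> chart_inv c (chart_map c q) = q;
  chart_map_continuous :
    forall q, chart_dom c q -> {for q, continuous (chart_map c)};
  chart_inv_continuous :
    forall x, chart_image c setT x -> {for x, continuous (chart_inv c)}
}.

Record manifold4 (R : realType) := Manifold4 {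
  carrier :> topologicalType;
  atlas : set (chart R carrier);
  manifold_hausdorff : hausdorff_space carrier;
  manifold_second_countable : @second_countable carrier;
  atlas_chart : forall c, atlas c -> is_chart c;
  atlas_cover : forall q : carrier, exists2 c, atlas c & chart_dom c q;
  atlas_smooth : forall c c', atlas c -> atlas c' -> forall i : 'I_4,
    Cinfty (chart_image c (chart_dom c'))
           (fun x => chart_map c' (chart_inv c x) 0 i)
}.

Section Tangent.
Variables (R : realType) (M : manifold4 R).

(* To be used for open U only. *)
Definition smooth_on (U : set M) (f : M -> R) : Prop :=
  forall c, atlas c -> Cinfty (chart_image c U) (f \o chart_inv c).

Definition smooth_near (p : M) (f : M -> R) : Prop :=
  exists2 U, open_nbhs p U & smooth_on U f.

(* Tangent vectors are the derivations at p of germs of smooth functions. They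
   are encoded as functionals on all of M -> R, with the value 0 on the functions
   that are not smooth near p, so that equality of functionals is equality of
   derivations. *)
Record derivation (p : M) (v : (M -> R) -> R^o) : Prop := {
  derivation_local : forall f h, (\forall q \near p, f q = h q) -> v f = v h;
  derivation_junk : forall f, ~ smooth_near p f -> v f = 0;
  derivation_linear : forall (a : R) f h, smooth_near p f -> smooth_near p h ->
    v (fun q => a * f q + h q) = a * v f + v h;
  derivation_leibniz : forall f h, smooth_near p f -> smooth_near p h ->
    v (fun q => f q * h q) = f p * v h + h p * v f
}.

Definition tangent_pred (p : M) : {pred (M -> R) -> R^o} :=
  fun v => `[< derivation p v >].

Fact tangent_submod_closed (p : M) : submod_closed (tangent_pred p).
Proof.
split=> [|a u v /asboolP[ul uj ua um] /asboolP[vl vj va vm]]; apply/asboolP.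
  split=> [//|//|b f h _ _|f h _ _].
    by rewrite -[RHS]/(b * 0 + 0 :> R) mulr0 addr0.
  by rewrite -[RHS]/(f p * 0 + h p * 0 :> R) !mulr0 addr0.
have E f : (a *: u + v) f = a * u f + v f by [].
split=> [f h fh|f nf|b f h sf sh|f h sf sh]; rewrite !E.
- by rewrite (ul f h fh) (vl f h fh).
- by rewrite uj // vj // mulr0 addr0.
- rewrite ua // va // !mulrDr -!addrA; congr (_ + _); first by rewrite mulrCA.
  by rewrite addrCA.
- rewrite um // vm // !mulrDr -!addrA mulrCA; congr (_ + _).
  by rewrite addrCA [a * (h p * _)]mulrCA.
Qed.

HB.instance Definition _ (p : M) :=
  GRing.isSubmodClosed.Build R ((M -> R) -> R^o) (tangent_pred p)
    (tangent_submod_closed p).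

Record tangent (p : M) := Tangent {
  tangent_val :> (M -> R) -> R^o;
  tangent_valP : tangent_val \in tangent_pred p
}.

HB.instance Definition _ (p : M) := [isSub for @tangent_val p].
HB.instance Definition _ (p : M) := [Choice of tangent p by <:].
HB.instance Definition _ (p : M) := [SubChoice_isSubLmodule of tangent p by <:].

Definition is_basis (p : M) (b : 'I_4 -> tangent p) : Prop :=
  (forall c : 'I_4 -> R, \sum_i c i *: b i = 0 -> forall i, c i = 0) /\
  (forall v, exists c : 'I_4 -> R, v = \sum_i c i *: b i).

Definition vfield : Type := forall p : M, tangent p.

Definition lie_derive (X : vfield) (f : M -> R) : M -> R := fun q => X q f.

Definition smooth_vfield (U : set M) (X : vfield) : Prop :=
  forall V f, open V -> V `<=` U -> smooth_on V f -> smooth_on V (lie_derive X f).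

(* [insubd 0] returns the functional itself when it is a derivation, which is the
   case where X and Y are smooth near q. *)
Definition lie_bracket (X Y : vfield) : vfield := fun q => insubd 0
  (fun f => if `[< smooth_near q f >]
            then lie_derive X (lie_derive Y f) q - lie_derive Y (lie_derive X f) q
            else 0).

Record riemannian_metric := RiemannianMetric {
  metric_form :> forall p : M, tangent p -> tangent p -> R;
  riemannian_linear : forall p (a : R) (x y z : tangent p),
    metric_form (a *: x + y) z = a * metric_form x z + metric_form y z;
  riemannian_sym : forall p (x y : tangent p), metric_form x y = metric_form y x;
  riemannian_pos : forall p (x : tangent p), x != 0 -> 0 < metric_form x x;
  riemannian_smooth : forall U (X Y : vfield), open U ->
    smooth_vfield U X -> smooth_vfield U Y ->
    smooth_on U (fun q => metric_form (X q) (Y q))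
}.

Record tensor11 := Tensor11 {
  tensor_map :> forall p : M, {linear tangent p -> tangent p};
  tensor_smooth : forall U (X : vfield), open U ->
    smooth_vfield U X -> smooth_vfield U (fun q => tensor_map q (X q))
}.

(* The Levi-Civita connection, as an operator on the vector fields that are
   smooth on some open set (its value elsewhere is unspecified). *)
Record levi_civita (g : riemannian_metric) (nabla : vfield -> vfield -> vfield) : Prop := {
  nabla_smooth : forall U X Y, open U -> smooth_vfield U X -> smooth_vfield U Y ->
    smooth_vfield U (nabla X Y);
  nabla_local : forall U X X' Y Y', open U ->
    smooth_vfield U X -> smooth_vfield U Y ->
    (forall q, U q -> X q = X' q) -> (forall q, U q -> Y q = Y' q) ->
    forall q, U q -> nabla X Y q = nabla X' Y' q;
  nabla_linearl : forall U f X X' Y, open U -> smooth_on U f ->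
    smooth_vfield U X -> smooth_vfield U X' -> smooth_vfield U Y ->
    forall q, U q ->
      nabla (fun q => f q *: X q + X' q) Y q = f q *: nabla X Y q + nabla X' Y q;
  nabla_addr : forall U X Y Y', open U ->
    smooth_vfield U X -> smooth_vfield U Y -> smooth_vfield U Y' ->
    forall q, U q -> nabla X (fun q => Y q + Y' q) q = nabla X Y q + nabla X Y' q;
  nabla_leibniz : forall U f X Y, open U -> smooth_on U f ->
    smooth_vfield U X -> smooth_vfield U Y ->
    forall q, U q ->
      nabla X (fun q => f q *: Y q) q = lie_derive X f q *: Y q + f q *: nabla X Y q;
  nabla_torsion_free : forall U X Y, open U ->
    smooth_vfield U X -> smooth_vfield U Y ->
    forall q, U q -> nabla X Y q - nabla Y X q = lie_bracket X Y q;
  nabla_metric : forall U X Y Z, open U ->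
    smooth_vfield U X -> smooth_vfield U Y -> smooth_vfield U Z ->
    forall q, U q ->
      lie_derive X (fun q => g q (Y q) (Z q)) q =
      g q (nabla X Y q) (Z q) + g q (Y q) (nabla X Z q)
}.

Definition curvature_field (nabla : vfield -> vfield -> vfield)
    (X Y Z : vfield) : vfield := fun q =>
  nabla X (nabla Y Z) q - nabla Y (nabla X Z) q - nabla (lie_bracket X Y) Z q.

(* R(x,y)z for tangent vectors at p: the value at p of R(X,Y)Z, for fields X, Y, Z
   that extend x, y, z smoothly near p (it does not depend on the extensions). *)
Definition curvature (nabla : vfield -> vfield -> vfield) (p : M)
    (x y z : tangent p) : tangent p :=
  xget 0 [set w | exists U X Y Z,
    [/\ open_nbhs p U, smooth_vfield U X, smooth_vfield U Y & smooth_vfield U Z] /\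
    [/\ X p = x, Y p = y, Z p = z & w = curvature_field nabla X Y Z p]].

Definition curvature4 (g : riemannian_metric) (nabla : vfield -> vfield -> vfield) (p : M)
    (x y z u : tangent p) : R := g p (curvature nabla x y z) u.

Definition associated_metric (g : riemannian_metric) (S : tensor11) (p : M)
    (x y : tangent p) : R := g p x (S p y) + g p (S p x) y.

Definition gram (p : M) (h : tangent p -> tangent p -> R) (b : 'I_4 -> tangent p) :
  'M[R]_4 := \matrix_(i, j) h (b i) (b j).

(* The contractions below are computed in a basis b of T_pM, and do not depend
   on it. *)
Definition ricci (g : riemannian_metric) (nabla : vfield -> vfield -> vfield) (p : M)
    (b : 'I_4 -> tangent p) (y z : tangent p) : R :=
  \sum_i \sum_j invmx (gram (@g p) b) i j * curvature4 g nabla (b i) y z (b j).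

Definition scalar_curvature (g : riemannian_metric) (nabla : vfield -> vfield -> vfield)
    (p : M) (b : 'I_4 -> tangent p) : R :=
  \sum_i \sum_j invmx (gram (@g p) b) i j * ricci g nabla b (b i) (b j).

Definition scalar_curvature_star (g : riemannian_metric) (S : tensor11)
    (nabla : vfield -> vfield -> vfield) (p : M) (b : 'I_4 -> tangent p) : R :=
  \sum_i \sum_j
    invmx (gram (@associated_metric g S p) b) i j * ricci g nabla b (b i) (b j).

Definition ricci_direction (g : riemannian_metric) (nabla : vfield -> vfield -> vfield)
    (p : M) (b : 'I_4 -> tangent p) (x : tangent p) : R :=
  ricci g nabla b x x / g p x x.

Definition angle (g : riemannian_metric) (p : M) (x y : tangent p) : R :=
  acos (g p x y / (Num.sqrt (g p x x) * Num.sqrt (g p y y))).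

Definition matrix4_of_rows (s : seq (seq R)) : 'M[R]_4 :=
  \matrix_(i, j) nth 0 (nth [::] s i) j.

Definition skew_circulant_S : 'M[R]_4 := matrix4_of_rows
  [:: [::  0; 1; 0; 0];
      [::  0; 0; 1; 0];
      [::  0; 0; 0; 1];
      [:: -1; 0; 0; 0]].

Definition skew_circulant_g (A B : R) : 'M[R]_4 := matrix4_of_rows
  [:: [::  A; B; 0; -B];
      [::  B; A; B;  0];
      [::  0; B; A;  B];
      [:: -B; 0; B;  A]].

Record adapted_frame (g : riemannian_metric) (S : tensor11) (U : set M)
    (e : 'I_4 -> vfield) : Prop := {
  frame_open : open U;
  frame_smooth : forall i, smooth_vfield U (e i);
  frame_basis : forall q, U q -> is_basis (fun i => e i q);
  frame_S : forall q, U q -> forall i,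
    S q (e i q) = \sum_j skew_circulant_S i j *: e j q;
  frame_g : exists A B : M -> R, [/\ smooth_on U A, smooth_on U B &
    forall q, U q ->
      gram (@g q) (fun i => e i q) = skew_circulant_g (A q) (B q) /\
      0 < Num.sqrt 2 * B q < A q]
}.

Record skew_circulant_manifold (g : riemannian_metric) (S : tensor11) : Prop := {
  S_isometry : forall p (x y : tangent p), g p (S p x) (S p y) = g p x y;
  S_adapted : forall p, exists U e, U p /\ adapted_frame g S U e
}.

Definition induces_S_basis (S : tensor11) (p : M) (x : tangent p) : Prop :=
  is_basis (fun i : 'I_4 => iter (3 - i)%N (S p) x).

End Tangent.

(* Main.v *)
Require Import Defs.
From HB Require Import structures.
From mathcomp Require Import all_boot all_order all_algebra.
From mathcomp Require Import all_classical all_reals all_analysis.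
From mathcomp Require Import ring lra.

Set Implicit Arguments.
Unset Strict Implicit.
Unset Printing Implicit Defensive.

Import Order.TTheory GRing.Theory Num.Theory.
Import numFieldNormedType.Exports.

Local Open Scope classical_set_scope.
Local Open Scope ring_scope.

(** Write rho for the Ricci tensor at p. A curvature tensor invariant under the
    isometry S has an S-invariant contraction, so rho(Sy,Sz) = rho(y,z)
    ([ricci_S]); together with g(Sy,Sz) = g(y,z) this gives r(Sy) = r(y) at once,
    and only r(x) remains to be computed.

    In the adapted frame S shifts the basis, with a sign when it wraps around. The
    Gram matrix of an S-invariant form therefore commutes with the matrix of S,
    and its symmetric part is determined by two numbers: it has the same
    skew-circulant shape as the matrix of g
    ([sym_invariant_skew_circulant_g]). The matrices of g and of the associated
    metric g~ are two linearly independent matrices of this shape, hence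
        rho(y,z) + rho(z,y) = s g(y,z) + t g~(y,z)
    for some scalars s, t ([invariant_form_sym]). The symmetric part of rho is all
    that the statement sees, because rho enters through quadratic values and
    through contractions with symmetric matrices. The metrics g and g~ are
    orthogonal to each other for both contractions and contract with themselves to
    4 ([metric_contractions]), so contracting the display yields 2 tau = 4 s and
    2 tau* = 4 t. As g~(x,x) = 2 g(x,Sx) and |Sx| = |x|, dividing
    rho(x,x) = (s/2) g(x,x) + t g(x,Sx) by g(x,x) gives
    tau/4 + (tau*/2) cos phi.

    This linear algebra needs the curvature at p to be multilinear in tangent
    vectors, whereas it is given through extensions to vector fields. The bulk of
    the text proves tensoriality: R(X,Y)Z is linear over smooth functions in X
    and in Z ([curvature_field_linearl], [curvature_field_linearr]) and
    antisymmetric in X, Y, and an operator that is linear over functions depends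
    on the value at p alone, since a field is a combination of the frame with
    smooth coefficients ([frame_coordinates], [tensorial_eq]). The coefficients
    are smooth because the inverse of the Gram matrix of the frame is, up to the
    nowhere vanishing factor A^2 - 2 B^2, again skew-circulant
    ([skew_circulant_gM]). *)

(** * Calculus of C^k functions *)

Lemma near_open_nbhs (T : topologicalType) (q : T) (P : T -> Prop) :
  (\forall r \near q, P r) -> exists2 W, open_nbhs q W & forall r, W r -> P r.
Proof.
move=> nP; have : nbhs q P by []; rewrite nbhsE => -[W oW WP].
by exists W => // r /WP.
Qed.

Section CkCalculus.
Variables (R : realType) (V : set 'rV[R]_4).
Implicit Types (f h : 'rV[R]_4 -> R) (k : nat).

Lemma CkW k f : Ck k.+1 V f -> Ck k V f.
Proof.
elim: k f => [|k IH] f [fc fd]; split => // i.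
by have [fdi fCi] := fd i; split => //; exact: IH.
Qed.

Lemma Ck_subset k (W : set 'rV[R]_4) f : W `<=` V -> Ck k V f -> Ck k W f.
Proof.
move=> WV; elim: k f => [|k IH] f [fc fd]; split => //.
- by move=> x /WV/fc.
- by move=> x /WV/fc.
- by move=> i; have [fdi fCi] := fd i; split; [move=> x /WV/fdi|exact: IH].
Qed.

Lemma Ck_eq k f h : open V -> (forall x, V x -> f x = h x) ->
  Ck k V f -> Ck k V h.
Proof.
move=> oV; elim: k f h => [|k IH] f h fh [fc fd].
all: have near_fh x : V x -> \near x, f x = h x
       by move=> Vx; apply: filterS (open_nbhs_nbhs (conj oV Vx)) => y /fh.
all: have hc x : V x -> {for x, continuous h}
       by move=> Vx; rewrite /prop_for /continuous_at -fh//;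
          apply: cvg_trans (fc x Vx); exact: near_eq_cvg (near_fh x Vx).
- by split.
- split => // i; have [fdi fCi] := fd i; split => [x Vx|].
    by apply: near_eq_derivable (fdi x Vx); exact: near_fh.
  apply: IH fCi => x Vx; apply: near_eq_derive; exact: near_fh.
Qed.

Lemma Ck_cst k (a : R) : Ck k V (fun=> a).
Proof.
have c0 (b : R) (x : 'rV[R]_4) : {for x, continuous (fun=> b)}.
  by rewrite /prop_for /continuous_at; exact: (@cst_continuous _ _ b).
elim: k a => [|k IH] a; split => // i; split; first by move=> x _; exact: derivable_cst.
suff -> : (fun x : 'rV[R]_4 => 'D_(delta_mx 0 i) (fun=> a) x) = fun=> 0 by [].
by apply/funext => x; exact: derive_cst.
Qed.

Hypothesis oV : open V.

(** Induction on k: the derivative of a sum, a product or an inverse is built by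
    the same operations from functions that are C^k again. *)
Lemma CkD k f h : Ck k V f -> Ck k V h -> Ck k V (fun x => f x + h x).
Proof.
elim: k f h => [|k IH] f h [fc fd] [hc hd]; split.
1,3: by move=> x Vx; apply: continuousD; [exact: fc|exact: hc].
- by [].
- move=> i; have [fdi fCi] := fd i; have [hdi hCi] := hd i; split.
    by move=> x Vx; apply: derivableD; [exact: fdi|exact: hdi].
  apply: (Ck_eq oV) (IH _ _ fCi hCi) => x Vx.
  by rewrite -deriveD; [|exact: fdi|exact: hdi].
Qed.

Lemma CkM k f h : Ck k V f -> Ck k V h -> Ck k V (fun x => f x * h x).
Proof.
elim: k f h => [|k IH] f h fC hC; have [fc fd] := fC; have [hc hd] := hC; split.
1,3: by move=> x Vx; apply: continuousM; [exact: fc|exact: hc].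
- by [].
- move=> i; have [fdi fCi] := fd i; have [hdi hCi] := hd i; split.
    by move=> x Vx; apply: derivableM; [exact: fdi|exact: hdi].
  apply: (Ck_eq oV) (CkD (IH _ _ (CkW fC) hCi) (IH _ _ (CkW hC) fCi)) => x Vx.
  by rewrite -deriveM; [|exact: fdi|exact: hdi].
Qed.

Lemma CkV k f : (forall x, V x -> f x != 0) -> Ck k V f ->
  Ck k V (fun x => (f x)^-1).
Proof.
move=> f0; elim: k => [|k IH] fC; have [fc fd] := fC; split.
1,3: by move=> x Vx; apply: continuousV; [exact: f0|exact: fc].
- by [].
- move=> i; have [fdi fCi] := fd i; split.
    by move=> x Vx; apply: derivableV; [exact: f0|exact: fdi].
  have fVC := IH (CkW fC).
  apply: (Ck_eq oV) (CkM (CkM (Ck_cst k (-1)) (CkM fVC fVC)) fCi) => x Vx.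
  rewrite deriveV; [|exact: f0|exact: fdi].
  by rewrite /GRing.scale /= mulN1r expr2 invfM.
Qed.

End CkCalculus.

(** * Smooth functions on open subsets of a manifold *)

Section SmoothFunctions.
Variables (R : realType) (M : manifold4 R).
Implicit Types (f h : M -> R) (U V : set M).

Lemma chart_image_mem (c : chart R M) V x : atlas c ->
  chart_image c V x -> chart_image c setT x /\ V (chart_inv c x).
Proof.
move=> /atlas_chart hc [q [Vq cq] <-]; split; first by exists q.
by rewrite (chart_mapK hc).
Qed.

(** The chart image of V is the part of the open image of the whole chart domain
    that the continuous inverse sends into V. *)
Lemma chart_image_is_open (c : chart R M) V : atlas c -> open V ->
  open (chart_image c V).
Proof.
move=> ac oV; have hc := atlas_chart ac.
rewrite openE => x cVx; have [cTx Vcx] := chart_image_mem ac cVx.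
have n1 : nbhs x (chart_image c setT).
  by apply: open_nbhs_nbhs; split; [exact: chart_image_open hc|].
have n2 : nbhs x (chart_inv c @^-1` V).
  by apply: (chart_inv_continuous hc cTx); exact: open_nbhs_nbhs.
apply: filterS2 n1 n2 => _ [q [_ cq] <-] /=.
by rewrite (chart_mapK hc)// => Vq; exists q.
Qed.

Lemma smooth_on_subset U V f : V `<=` U -> smooth_on U f -> smooth_on V f.
Proof.
move=> VU sf c ac k; apply: Ck_subset (sf c ac k).
by move=> _ [q [Vq cq] <-]; exists q => //; split => //; exact: VU.
Qed.

Lemma smooth_on_eq U f h : open U -> (forall q, U q -> f q = h q) ->
  smooth_on U f -> smooth_on U h.
Proof.
move=> oU fh sf c ac k; apply: (Ck_eq (chart_image_is_open ac oU)) (sf c ac k).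
by move=> x /(chart_image_mem ac)[_ /fh].
Qed.

Lemma smooth_on_cst U (a : R) : smooth_on U (fun=> a).
Proof. by move=> c ac k; exact: Ck_cst. Qed.

Lemma smooth_onD U f h : open U -> smooth_on U f -> smooth_on U h ->
  smooth_on U (fun q => f q + h q).
Proof.
move=> oU sf sh c ac k.
exact: (CkD (chart_image_is_open ac oU) (sf c ac k) (sh c ac k)).
Qed.

Lemma smooth_onM U f h : open U -> smooth_on U f -> smooth_on U h ->
  smooth_on U (fun q => f q * h q).
Proof.
move=> oU sf sh c ac k.
exact: (CkM (chart_image_is_open ac oU) (sf c ac k) (sh c ac k)).
Qed.

Lemma smooth_onV U f : open U -> (forall q, U q -> f q != 0) ->
  smooth_on U f -> smooth_on U (fun q => (f q)^-1).
Proof.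
move=> oU f0 sf c ac k; apply: (CkV (chart_image_is_open ac oU) _ (sf c ac k)).
by move=> x /(chart_image_mem ac)[_ /f0].
Qed.

Lemma smooth_onN U f : open U -> smooth_on U f -> smooth_on U (fun q => - f q).
Proof.
move=> oU sf; apply: (smooth_on_eq oU) (smooth_onM oU (smooth_on_cst U (-1)) sf).
by move=> q _; rewrite mulN1r.
Qed.

Lemma smooth_on_sum U (I : finType) (F : I -> M -> R) : open U ->
  (forall i, smooth_on U (F i)) -> smooth_on U (fun q => \sum_i F i q).
Proof.
move=> oU sF.
suff : forall s : seq I, smooth_on U (fun q => \sum_(i <- s) F i q).
  by move=> /(_ (index_enum I)).
elim=> [|i s IH].
  by apply: (smooth_on_eq oU) (smooth_on_cst U 0) => q _; rewrite big_nil.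
apply: (smooth_on_eq oU) (smooth_onD oU (sF i) IH) => q _.
by rewrite big_cons.
Qed.

Lemma smooth_on_near U q f : open U -> U q -> smooth_on U f -> smooth_near q f.
Proof. by move=> oU Uq sf; exists U. Qed.

Lemma smooth_near_eq q f h : (\forall r \near q, f r = h r) ->
  smooth_near q f -> smooth_near q h.
Proof.
move=> /near_open_nbhs[W oW fh] [U oU sf]; exists (U `&` W); first exact: open_nbhsI.
apply: (@smooth_on_eq _ f); first exact: openI (oU.1) (oW.1).
  by move=> r [_ /fh].
by apply: smooth_on_subset sf => r [].
Qed.

End SmoothFunctions.

(** * Smooth vector fields and the Lie bracket *)

Section VectorFields.
Variables (R : realType) (M : manifold4 R).
Implicit Types (f h : M -> R) (U V : set M) (X Y Z : vfield M).

Lemma tangentP (q : M) (v : tangent q) : derivation q v.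
Proof. by have /asboolP := tangent_valP v. Qed.

Lemma tangent_ext (q : M) (v w : tangent q) : (forall f, v f = w f) -> v = w.
Proof. by move=> vw; apply/val_inj/funext => f; exact: vw. Qed.

Lemma tangentDE (q : M) (v w : tangent q) f : (v + w) f = v f + w f.
Proof. by []. Qed.

Lemma tangentZE (q : M) (a : R) (v : tangent q) f : (a *: v) f = a * v f.
Proof. by []. Qed.

Lemma tangentNE (q : M) (v : tangent q) f : (- v) f = - v f.
Proof. by []. Qed.

Lemma smooth_vfield_subset U V X : V `<=` U -> smooth_vfield U X -> smooth_vfield V X.
Proof. by move=> VU sX W f oW WV; apply: sX => //; exact: subset_trans VU. Qed.

Lemma smooth_lie_derive U X f : open U -> smooth_vfield U X -> smooth_on U f ->
  smooth_on U (lie_derive X f).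
Proof. by move=> oU sX; exact: sX. Qed.

Lemma smooth_vfield_eq U X Y : (forall q, U q -> X q = Y q) ->
  smooth_vfield U X -> smooth_vfield U Y.
Proof.
move=> XY sX V f oV VU sf; apply: (smooth_on_eq oV) (sX V f oV VU sf).
by move=> q /VU /XY; rewrite /lie_derive => ->.
Qed.

Lemma smooth_vfield_axpy U f X Y : smooth_on U f ->
  smooth_vfield U X -> smooth_vfield U Y ->
  smooth_vfield U (fun q => f q *: X q + Y q).
Proof.
move=> sf sX sY V h oV VU sh.
apply: (smooth_on_eq oV) (smooth_onD oV (smooth_onM oV (smooth_on_subset VU sf)
  (sX V h oV VU sh)) (sY V h oV VU sh)) => q _.
by rewrite /lie_derive tangentDE tangentZE.
Qed.

Lemma smooth_vfield0 U : smooth_vfield U (fun=> 0 : tangent _).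
Proof. by move=> V f oV VU sf; exact: smooth_on_cst. Qed.

Lemma smooth_vfieldZ U f X : smooth_on U f -> smooth_vfield U X ->
  smooth_vfield U (fun q => f q *: X q).
Proof.
move=> sf sX; apply: smooth_vfield_eq (smooth_vfield_axpy sf sX (@smooth_vfield0 U)).
by move=> q _; rewrite addr0.
Qed.

Lemma lie_derive_eq U X f h : open U -> (forall q, U q -> f q = h q) ->
  forall q, U q -> lie_derive X f q = lie_derive X h q.
Proof.
move=> oU fh q Uq; apply: (derivation_local (tangentP (X q))).
by apply: filterS (open_nbhs_nbhs (conj oU Uq)) => r /fh.
Qed.

Lemma lie_derive_linear U X (a : R) f h : open U -> smooth_on U f -> smooth_on U h ->
  forall q, U q -> lie_derive X (fun r => a * f r + h r) q =
    a * lie_derive X f q + lie_derive X h q.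
Proof.
move=> oU sf sh q Uq; apply: (derivation_linear (tangentP (X q)));
exact: smooth_on_near Uq _.
Qed.

Lemma lie_derive_leibniz U X f h : open U -> smooth_on U f -> smooth_on U h ->
  forall q, U q -> lie_derive X (fun r => f r * h r) q =
    f q * lie_derive X h q + h q * lie_derive X f q.
Proof.
move=> oU sf sh q Uq; apply: (derivation_leibniz (tangentP (X q)));
exact: smooth_on_near Uq _.
Qed.

Lemma lie_deriveD U X f h : open U -> smooth_on U f -> smooth_on U h ->
  forall q, U q -> lie_derive X (fun r => f r + h r) q =
    lie_derive X f q + lie_derive X h q.
Proof.
move=> oU sf sh q Uq; rewrite -[lie_derive X f q]mul1r -(lie_derive_linear _ _ oU)//.
by apply: (lie_derive_eq _ oU) => // r _; rewrite mul1r.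
Qed.

Definition commutator X Y f : M -> R := fun q =>
  lie_derive X (lie_derive Y f) q - lie_derive Y (lie_derive X f) q.

Section Commutator.
Variables (N : set M) (X Y : vfield M) (q : M).
Hypotheses (oN : open N) (Nq : N q).
Hypotheses (sX : smooth_vfield N X) (sY : smooth_vfield N Y).

Lemma commutator_eq f h : (forall r, N r -> f r = h r) ->
  commutator X Y f q = commutator X Y h q.
Proof.
move=> fh; rewrite /commutator.
by congr (_ - _); apply: (lie_derive_eq _ oN) => // r; exact: lie_derive_eq.
Qed.

Lemma commutator_linear (a : R) f h : smooth_on N f -> smooth_on N h ->
  commutator X Y (fun r => a * f r + h r) q =
  a * commutator X Y f q + commutator X Y h q.
Proof.
move=> sf sh; rewrite /commutator.
rewrite (lie_derive_eq X oN (lie_derive_linear Y a oN sf sh) Nq).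
rewrite (lie_derive_eq Y oN (lie_derive_linear X a oN sf sh) Nq).
rewrite !(lie_derive_linear _ _ oN _ _ Nq)//; try exact: smooth_lie_derive.
by ring.
Qed.

(** The cross terms (X f)(Y h) and (Y f)(X h) of the second derivatives cancel. *)
Lemma commutator_leibniz f h : smooth_on N f -> smooth_on N h ->
  commutator X Y (fun r => f r * h r) q =
  f q * commutator X Y h q + h q * commutator X Y f q.
Proof.
move=> sf sh; rewrite /commutator.
rewrite (lie_derive_eq X oN (lie_derive_leibniz Y oN sf sh) Nq).
rewrite (lie_derive_eq Y oN (lie_derive_leibniz X oN sf sh) Nq).
rewrite !(lie_deriveD _ oN _ _ Nq);
  try by apply: smooth_onM => //; exact: smooth_lie_derive.
rewrite !(lie_derive_leibniz _ oN _ _ Nq)//; try exact: smooth_lie_derive.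
by ring.
Qed.

End Commutator.

(** The commutator of two fields that are smooth near q is a derivation at q, so
    that the Lie bracket is this commutator and not its default value. *)
Lemma lie_bracketE U X Y f q : open U -> U q ->
  smooth_vfield U X -> smooth_vfield U Y -> smooth_on U f ->
  lie_bracket X Y q f = commutator X Y f q.
Proof.
move=> oU Uq sX sY sf.
set b := fun f : M -> R =>
  (if `[< smooth_near q f >] then commutator X Y f q else 0) : R^o.
have bE u : smooth_near q u -> b u = commutator X Y u q.
  by move=> su; rewrite /b asboolT.
have common u v : smooth_near q u -> smooth_near q v -> exists N,
    [/\ open N, N q & [/\ smooth_on N u, smooth_on N v,
       smooth_vfield N X & smooth_vfield N Y]].
  move=> [V [oV Vq] su] [W [oW Wq] sv]; exists (U `&` V `&` W).
  split; [by apply: openI => //; exact: openI|by []|split].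
  - by apply: smooth_on_subset su => r [[]].
  - by apply: smooth_on_subset sv => r [].
  - by apply: smooth_vfield_subset sX => r [[]].
  - by apply: smooth_vfield_subset sY => r [[]].
have b_der : derivation q b.
  split.
  - move=> u v uv; have [su|nsu] := pselect (smooth_near q u); last first.
      rewrite /b !asboolF// => sv; apply: nsu; apply: smooth_near_eq sv.
      by apply: filterS uv => r ->.
    rewrite !bE//; last exact: smooth_near_eq uv su.
    have [N [oN Nq] {}uv] := near_open_nbhs uv; exact: (commutator_eq _ _ oN Nq).
  - by move=> u nsu; rewrite /b asboolF.
  - move=> a u v su sv; have [N [oN Nq [sNu sNv sNX sNY]]] := common _ _ su sv.
    rewrite !bE//; first exact: (commutator_linear oN Nq sNX sNY).
    apply: (smooth_on_near oN Nq); apply: smooth_onD => //.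
    by apply: smooth_onM => //; exact: smooth_on_cst.
  - move=> u v su sv; have [N [oN Nq [sNu sNv sNX sNY]]] := common _ _ su sv.
    rewrite !bE//; first exact: (commutator_leibniz oN Nq sNX sNY).
    by apply: (smooth_on_near oN Nq); exact: smooth_onM.
have bP : b \in tangent_pred q by apply/asboolP.
rewrite /lie_bracket.
have -> : tangent_val (insubd (0 : tangent q) b) = b by rewrite -[LHS]/(val _) insubdK.
by rewrite bE//; exact: smooth_on_near Uq sf.
Qed.

End VectorFields.

(** * Inverting the Gram matrix of an adapted frame *)

Section SkewCirculantMatrices.
Variable (R : realType).
Implicit Types (A B : R).

(** Not the determinant of the matrix of g, which is the square of this number. *)
Definition skew_circulant_det A B := A ^+ 2 - 2 * B ^+ 2.

(** Changing the sign of B inverts the matrix up to a scalar: with K the matrix of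
    S, the matrix of g is A + B (K + K^-1), and (K + K^-1)^2 = 2 because
    K^-2 = - K^2. *)
Lemma skew_circulant_gM A B :
  skew_circulant_g A B *m skew_circulant_g A (- B) = (skew_circulant_det A B)%:M.
Proof.
apply/matrixP => i j; rewrite !mxE !big_ord_recl big_ord0 !mxE.
case: i => [[|[|[|[|//]]]] ?]; case: j => [[|[|[|[|//]]]] ?] /=;
by rewrite /skew_circulant_det; ring.
Qed.

Lemma skew_circulant_det_gt0 A B :
  0 < Num.sqrt 2 * B < A -> 0 < skew_circulant_det A B.
Proof.
move=> /andP[B0 BA].
have : (Num.sqrt 2 * B) ^+ 2 < A ^+ 2 by rewrite ltr_pXn2r// nnegrE ltW//; lra.
by rewrite exprMn sqr_sqrtr// subr_gt0.
Qed.

End SkewCirculantMatrices.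

(** * Bilinear forms *)

Section BilinearForms.
Variables (R : realType) (V : lmodType R).
Implicit Types (h : V -> V -> R) (x y z : V).

Definition bilinear_form h :=
  (forall a x y z, h (a *: x + y) z = a * h x z + h y z) /\
  (forall a x y z, h z (a *: x + y) = a * h z x + h z y).

Section Theory.
Variable h : V -> V -> R.
Hypothesis hh : bilinear_form h.

Lemma formDl x y z : h (x + y) z = h x z + h y z.
Proof. by rewrite -[x]scale1r hh.1 mul1r scale1r. Qed.

Lemma formDr x y z : h z (x + y) = h z x + h z y.
Proof. by rewrite -[x]scale1r hh.2 mul1r scale1r. Qed.

Lemma form0l z : h 0 z = 0.
Proof. by apply: (addrI (h 0 z)); rewrite -formDl !addr0. Qed.

Lemma form0r z : h z 0 = 0.
Proof. by apply: (addrI (h z 0)); rewrite -formDr !addr0. Qed.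

Lemma formZl a x z : h (a *: x) z = a * h x z.
Proof. by rewrite -[a *: x]addr0 hh.1 form0l addr0. Qed.

Lemma formZr a x z : h z (a *: x) = a * h z x.
Proof. by rewrite -[a *: x]addr0 hh.2 form0r addr0. Qed.

Lemma form_suml (I : finType) (F : I -> V) z : h (\sum_i F i) z = \sum_i h (F i) z.
Proof.
by apply: (big_morph (h^~ z)) => [x y|]; [exact: formDl|exact: form0l].
Qed.

Lemma form_sumr (I : finType) (F : I -> V) z : h z (\sum_i F i) = \sum_i h z (F i).
Proof.
by apply: (big_morph (h z)) => [x y|]; [exact: formDr|exact: form0r].
Qed.

End Theory.

End BilinearForms.

Lemma metric_bilinear (R : realType) (M : manifold4 R) (g : riemannian_metric M) (p : M) :
  bilinear_form (@g p).
Proof.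
split=> a x y z; first exact: riemannian_linear.
by rewrite riemannian_sym riemannian_linear !(riemannian_sym _ z).
Qed.

(** * Frame coordinates and tensoriality *)

Section Frame.
Variables (R : realType) (M : manifold4 R) (g : riemannian_metric M)
  (S : tensor11 M) (U : set M) (e : 'I_4 -> vfield M).
Hypothesis he : adapted_frame g S U e.

(** The coefficients of X are the values g(X,e_j) multiplied by the inverse Gram
    matrix, which [skew_circulant_gM] makes a smooth function of A and B. *)
Lemma frame_coordinates V (X : vfield M) : open V -> V `<=` U ->
  smooth_vfield V X ->
  exists f : 'I_4 -> M -> R, (forall i, smooth_on V (f i)) /\
    (forall q, V q -> X q = \sum_i f i q *: e i q).
Proof.
move=> oV VU sX; have [A [B [sA sB hAB]]] := frame_g he.
have {}sA := smooth_on_subset VU sA; have {}sB := smooth_on_subset VU sB.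
have se i : smooth_vfield V (e i) by apply: smooth_vfield_subset (frame_smooth he i).
pose D q := skew_circulant_det (A q) (B q).
have D0 q : V q -> D q != 0.
  by move=> /VU /hAB[_ /skew_circulant_det_gt0]; rewrite lt0r => /andP[].
have sD : smooth_on V D.
  apply: smooth_onD => //; first exact: smooth_onM.
  apply: smooth_onN => //; apply: smooth_onM => //; last exact: smooth_onM.
  exact: smooth_on_cst.
pose H q := skew_circulant_g (A q) (- B q).
have sH i j : smooth_on V (fun q => H q i j).
  have sN := smooth_onN oV sB; have s0 := @smooth_on_cst _ _ V 0.
  have sNN := smooth_onN oV sN.
  apply: (smooth_on_eq oV
    (f := fun q => nth 0 (nth [::]
      [:: [:: A q; - B q; 0; - - B q]; [:: - B q; A q; - B q; 0];
          [:: 0; - B q; A q; - B q]; [:: - - B q; 0; - B q; A q]] i) j)).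
    by move=> q _; rewrite /H mxE.
  by case: i => [[|[|[|[|//]]]] ?]; case: j => [[|[|[|[|//]]]] ?].
exists (fun i q => (D q)^-1 * \sum_j g q (X q) (e j q) * H q j i); split.
  move=> i; apply: smooth_onM => //; first exact: smooth_onV.
  apply: smooth_on_sum => // j; apply: smooth_onM => //.
  exact: riemannian_smooth.
move=> q Vq; have [_ /(_ (X q))[c Xc]] := frame_basis he (VU _ Vq).
have [Gq _] := hAB q (VU _ Vq).
rewrite {1}Xc; apply: eq_bigr => i _; congr (_ *: _).
apply: (mulfI (D0 q Vq)); rewrite mulVKf ?D0//.
have -> : D q * c i = \sum_k c k * (D q)%:M k i.
  rewrite (bigD1 i)//= mxE eqxx mulr1n big1 ?addr0 1?mulrC// => k /negbTE ki.
  by rewrite mxE ki mulr0n mulr0.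
rewrite /D -skew_circulant_gM -Gq.
under eq_bigr => k _ do rewrite mxE mulr_sumr.
rewrite exchange_big; apply: eq_bigr => j _ /=.
have gb := metric_bilinear g q.
rewrite Xc (form_suml gb) mulr_suml; apply: eq_bigr => k _.
by rewrite (formZl gb) mulrA !mxE.
Qed.

Lemma frame_extension q (v : tangent q) : U q ->
  exists2 X : vfield M, smooth_vfield U X & X q = v.
Proof.
move=> Uq; have [_ /(_ v)[c ->]] := frame_basis he Uq.
exists (fun r => \sum_i c i *: e i r) => //.
elim: (index_enum _) => [|i s IH].
  by apply: smooth_vfield_eq (@smooth_vfield0 _ _ U) => r _; rewrite big_nil.
apply: (smooth_vfield_eq (X := fun r => c i *: e i r + \sum_(j <- s) c j *: e j r)).
  by move=> r _; rewrite big_cons.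
exact: smooth_vfield_axpy (smooth_on_cst U (c i)) (frame_smooth he i) IH.
Qed.

(** Write the difference of the two fields in the frame: its coefficients vanish at
    q, and T turns them into scalar factors. *)
Lemma tensorial_eq (W : lmodType R) q V (T : vfield M -> W) : open V -> V `<=` U -> V q ->
  (forall X X', smooth_vfield V X -> (forall r, V r -> X r = X' r) -> T X = T X') ->
  (forall f X X', smooth_on V f -> smooth_vfield V X -> smooth_vfield V X' ->
    T (fun r => f r *: X r + X' r) = f q *: T X + T X') ->
  forall X X', smooth_vfield V X -> smooth_vfield V X' -> X q = X' q -> T X = T X'.
Proof.
move=> oV VU Vq Tloc Tlin.
have s0 := @smooth_vfield0 _ M V.
have T0 : T (fun=> 0 : tangent _) = 0.
  apply: (addrI (T (fun=> 0 : tangent _))); rewrite addr0 -[X in X + _]scale1r.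
  rewrite -(Tlin (fun=> 1) _ _ (smooth_on_cst V 1) s0 s0).
  apply: (Tloc) => [|r _]; last by rewrite scale1r addr0.
  exact: (smooth_vfield_axpy (smooth_on_cst V 1) s0 s0).
have van X : smooth_vfield V X -> X q = 0 -> T X = 0.
  move=> sX X0; have [f [sf Xf]] := frame_coordinates oV VU sX.
  have f0 i : f i q = 0.
    have [free _] := frame_basis he (VU _ Vq).
    by apply: (free (fun i => f i q)); rewrite -Xf.
  rewrite (Tloc X (fun r => \sum_i f i r *: e i r))//.
  have se i : smooth_vfield V (e i) by apply: smooth_vfield_subset (frame_smooth he i).
  suff [] : smooth_vfield V (fun r => \sum_i f i r *: e i r) /\
    T (fun r => \sum_i f i r *: e i r) = 0 by [].
  elim: (index_enum _) => [|i s [IHs IH]].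
    have nilE r : 0 = \sum_(i <- [::]) f i r *: e i r :> tangent r by rewrite big_nil.
    split; first by apply: smooth_vfield_eq s0 => r _; exact: nilE.
    by rewrite -(Tloc (fun=> 0))// => r _; exact: nilE.
  have consE r : f i r *: e i r + \sum_(j <- s) f j r *: e j r =
    \sum_(j <- i :: s) f j r *: e j r by rewrite big_cons.
  have sc := smooth_vfield_axpy (sf i) (se i) IHs.
  split; first by apply: smooth_vfield_eq sc => r _; exact: consE.
  rewrite -(Tloc _ _ sc); last by move=> r _; exact: consE.
  by rewrite Tlin// f0 scale0r IH addr0.
move=> X X' sX sX' XX'.
have := Tlin (fun=> -1) _ _ (smooth_on_cst V (-1)) sX' sX.
rewrite van.
- by rewrite scaleN1r addrC => /eqP; rewrite eq_sym subr_eq0 => /eqP.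
- exact: smooth_vfield_axpy (smooth_on_cst V (-1)) sX' sX.
- by rewrite scaleN1r XX' addNr.
Qed.

End Frame.

(** * Curvature of vector fields *)

Section CurvatureField.
Variables (R : realType) (M : manifold4 R) (g : riemannian_metric M)
  (nabla : vfield M -> vfield M -> vfield M).
Hypothesis hnabla : levi_civita g nabla.
Variables (U : set M).
Hypothesis oU : open U.
Implicit Types (f : M -> R) (X Y Z : vfield M).
Local Notation smooth := (smooth_vfield U).
Local Notation Rm := (curvature_field nabla).

Lemma smooth_vfieldB X Y : smooth X -> smooth Y -> smooth (fun q => X q - Y q).
Proof.
move=> sX sY; apply: smooth_vfield_eq (smooth_vfield_axpy (smooth_on_cst U (-1)) sY sX).
by move=> q _; rewrite scaleN1r addrC.
Qed.

Lemma smooth_nabla X Y : smooth X -> smooth Y -> smooth (nabla X Y).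
Proof. exact: (nabla_smooth hnabla). Qed.

Lemma smooth_lie_bracket X Y : smooth X -> smooth Y -> smooth (lie_bracket X Y).
Proof.
move=> sX sY.
apply: (smooth_vfield_eq (nabla_torsion_free hnabla oU sX sY)).
by apply: smooth_vfieldB; exact: smooth_nabla.
Qed.

Lemma nabla_axpyr f X Y Y' q : smooth_on U f -> smooth X -> smooth Y -> smooth Y' ->
  U q -> nabla X (fun q => f q *: Y q + Y' q) q =
         lie_derive X f q *: Y q + f q *: nabla X Y q + nabla X Y' q.
Proof.
move=> sf sX sY sY' Uq; rewrite -(nabla_leibniz hnabla oU)//.
by rewrite (nabla_addr hnabla oU)//; exact: smooth_vfieldZ.
Qed.

(** Torsion-freeness expresses brackets of smooth fields through nabla, so the
    Leibniz rule for brackets follows from the rules for nabla. *)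
Lemma lie_bracket_axpyl f X X' Y q : smooth_on U f ->
  smooth X -> smooth X' -> smooth Y -> U q ->
  lie_bracket (fun q => f q *: X q + X' q) Y q =
  f q *: lie_bracket X Y q + (- lie_derive Y f q *: X q + lie_bracket X' Y q).
Proof.
move=> sf sX sX' sY Uq; have sfX := smooth_vfield_axpy sf sX sX'.
rewrite -!(nabla_torsion_free hnabla oU)// (nabla_linearl hnabla oU)//.
rewrite nabla_axpyr//; apply: tangent_ext => h.
by rewrite !(tangentDE, tangentNE, tangentZE); ring.
Qed.

Lemma lie_bracketN X Y q : smooth X -> smooth Y -> U q ->
  lie_bracket Y X q = - lie_bracket X Y q.
Proof.
by move=> sX sY Uq; rewrite -!(nabla_torsion_free hnabla oU)// opprB.
Qed.

Lemma curvature_field_local X X' Y Y' Z Z' q : smooth X -> smooth Y -> smooth Z ->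
  (forall q, U q -> X q = X' q) -> (forall q, U q -> Y q = Y' q) ->
  (forall q, U q -> Z q = Z' q) -> U q -> Rm X Y Z q = Rm X' Y' Z' q.
Proof.
move=> sX sY sZ XX YY ZZ Uq.
have loc := nabla_local hnabla oU.
have sX' := smooth_vfield_eq XX sX; have sY' := smooth_vfield_eq YY sY.
rewrite /curvature_field; congr (_ - _ - _).
- by apply: (loc) => //; [exact: smooth_nabla|move=> r Ur; exact: loc].
- by apply: (loc) => //; [exact: smooth_nabla|move=> r Ur; exact: loc].
- apply: (loc) => //; first exact: smooth_lie_bracket.
  move=> r Ur; rewrite -!(nabla_torsion_free hnabla oU)//.
  by congr (_ - _); apply: loc.
Qed.

Lemma curvature_field_anti X Y Z q : smooth X -> smooth Y -> smooth Z -> U q ->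
  Rm Y X Z q = - Rm X Y Z q.
Proof.
move=> sX sY sZ Uq; rewrite /curvature_field.
have sb := smooth_lie_bracket sX sY; have s0 := @smooth_vfield0 _ M U.
have s1 := smooth_on_cst U (-1 : R).
have n0 : nabla (fun=> 0 : tangent _) Z q = 0.
  apply: (addrI (nabla (fun=> 0 : tangent _) Z q)); rewrite addr0.
  rewrite -[X in X + _]scale1r.
  rewrite -(nabla_linearl hnabla oU (smooth_on_cst U (1 : R)) s0 s0 sZ Uq).
  apply: (nabla_local hnabla oU _ sZ) => // [|r _]; last by rewrite scale1r addr0.
  exact: (smooth_vfield_axpy (smooth_on_cst U (1 : R)) s0 s0).
rewrite -(nabla_local hnabla oU (X := fun q => -1 *: lie_bracket X Y q + 0)
  (X' := lie_bracket Y X) (Y' := Z) _ sZ _ _ Uq)//.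
- rewrite (nabla_linearl hnabla oU)// n0.
  by rewrite addr0 scaleN1r !opprD !opprK [- _ + _]addrC.
- exact: smooth_vfield_axpy.
- by move=> r Ur; rewrite addr0 scaleN1r -lie_bracketN.
Qed.

(** The term (Y f) nabla_X Z produced by differentiating f cancels with the one
    coming from the Leibniz rule of [fX, Y]. *)
Lemma curvature_field_linearl f X X' Y Z q : smooth_on U f ->
  smooth X -> smooth X' -> smooth Y -> smooth Z -> U q ->
  Rm (fun q => f q *: X q + X' q) Y Z q = f q *: Rm X Y Z q + Rm X' Y Z q.
Proof.
move=> sf sX sX' sY sZ Uq; have sfX := smooth_vfield_axpy sf sX sX'.
rewrite /curvature_field.
have sb := smooth_lie_bracket.
have E1 : nabla Y (nabla (fun q => f q *: X q + X' q) Z) q =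
    nabla Y (fun q => f q *: nabla X Z q + nabla X' Z q) q.
  apply: (nabla_local hnabla oU) => //; first exact: smooth_nabla.
  by move=> r Ur; exact: (nabla_linearl hnabla oU).
have E2 : nabla (lie_bracket (fun q => f q *: X q + X' q) Y) Z q =
    nabla (fun q => f q *: lie_bracket X Y q +
      (- lie_derive Y f q *: X q + lie_bracket X' Y q)) Z q.
  apply: (nabla_local hnabla oU) => //; first exact: sb.
  by move=> r Ur; exact: lie_bracket_axpyl.
have sYf : smooth_on U (fun r => - lie_derive Y f r).
  by apply: smooth_onN => //; exact: smooth_lie_derive.
rewrite E1 E2 !(nabla_linearl hnabla oU)//; try exact: smooth_nabla; try exact: sb.
  rewrite nabla_axpyr//; try exact: smooth_nabla.
  apply: tangent_ext => h; rewrite !(tangentDE, tangentNE, tangentZE); ring.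
by apply: smooth_vfield_axpy => //; exact: sb.
Qed.

(** In nabla_X nabla_Y (f Z) the first derivatives of f appear symmetrically in X
    and Y, and the second derivatives leave ([X, Y] f) Z, which nabla_[X,Y] (f Z)
    removes. *)
Lemma curvature_field_linearr f X Y Z Z' q : smooth_on U f ->
  smooth X -> smooth Y -> smooth Z -> smooth Z' -> U q ->
  Rm X Y (fun q => f q *: Z q + Z' q) q = f q *: Rm X Y Z q + Rm X Y Z' q.
Proof.
move=> sf sX sY sZ sZ' Uq; have sfZ := smooth_vfield_axpy sf sZ sZ'.
have hess X1 Y1 : smooth X1 -> smooth Y1 ->
    nabla X1 (nabla Y1 (fun q => f q *: Z q + Z' q)) q =
    lie_derive X1 (lie_derive Y1 f) q *: Z q + lie_derive Y1 f q *: nabla X1 Z q +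
    (lie_derive X1 f q *: nabla Y1 Z q + f q *: nabla X1 (nabla Y1 Z) q +
     nabla X1 (nabla Y1 Z') q).
  move=> sX1 sY1; have sn := smooth_nabla; have sl := smooth_lie_derive oU sY1 sf.
  have sin : smooth (fun r => f r *: nabla Y1 Z r + nabla Y1 Z' r).
    by apply: smooth_vfield_axpy => //; exact: sn.
  rewrite -[in RHS]nabla_axpyr//; try exact: sn.
  rewrite -nabla_axpyr//.
  apply: (nabla_local hnabla oU) => //; first exact: sn.
  by move=> r Ur; rewrite nabla_axpyr// addrA.
rewrite /curvature_field !hess// nabla_axpyr//; last exact: smooth_lie_bracket.
rewrite [lie_derive (lie_bracket X Y) f q](lie_bracketE oU)// /commutator.
apply: tangent_ext => h; rewrite !(tangentDE, tangentNE, tangentZE); ring.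
Qed.

End CurvatureField.

(** * Curvature of tangent vectors *)

Section Curvature.
Variables (R : realType) (M : manifold4 R) (g : riemannian_metric M)
  (S : tensor11 M) (nabla : vfield M -> vfield M -> vfield M).
Hypothesis hnabla : levi_civita g nabla.
Variables (U : set M) (e : 'I_4 -> vfield M).
Hypothesis he : adapted_frame g S U e.
Variable (p : M).
Hypothesis Up : U p.
Let oU := frame_open he.

Lemma curvature_field_tensorial V X X' Y Y' Z Z' : open V -> V `<=` U -> V p ->
  smooth_vfield V X -> smooth_vfield V X' -> smooth_vfield V Y ->
  smooth_vfield V Y' -> smooth_vfield V Z -> smooth_vfield V Z' ->
  X p = X' p -> Y p = Y' p -> Z p = Z' p ->
  curvature_field nabla X Y Z p = curvature_field nabla X' Y' Z' p.
Proof.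
move=> oV VU Vp sX sX' sY sY' sZ sZ' XX YY ZZ.
have loc := curvature_field_local hnabla oV.
have slot1 A B C A' : smooth_vfield V A -> smooth_vfield V A' -> smooth_vfield V B ->
    smooth_vfield V C -> A p = A' p ->
    curvature_field nabla A B C p = curvature_field nabla A' B C p.
  move=> sA sA' sB sC AA.
  apply: (tensorial_eq he oV VU Vp (T := fun A => curvature_field nabla A B C p)) AA => //.
  - by move=> A1 A2 sA1 A12; exact: loc.
  - by move=> f A1 A2 sf s1 s2; exact: (curvature_field_linearl hnabla oV).
have anti := curvature_field_anti hnabla oV.
rewrite (slot1 X Y Z X')// anti// (slot1 Y X' Z Y')// -anti//.
apply: (tensorial_eq he oV VU Vp (T := fun C => curvature_field nabla X' Y' C p)) ZZ => //.
- by move=> A1 A2 sA1 A12; exact: loc.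
- by move=> f A1 A2 sf s1 s2; exact: (curvature_field_linearr hnabla oV).
Qed.

(** Any extensions that the choice operator may have picked are comparable with
    X, Y, Z on the intersection of the two domains. *)
Lemma curvatureE X Y Z : smooth_vfield U X -> smooth_vfield U Y -> smooth_vfield U Z ->
  curvature nabla (X p) (Y p) (Z p) = curvature_field nabla X Y Z p.
Proof.
move=> sX sY sZ; rewrite /curvature; set P := [set w | _].
have : P (xget 0 P).
  by apply: xgetPex; exists (curvature_field nabla X Y Z p), U, X, Y, Z.
move=> [V [X' [Y' [Z' [[[oV Vp] sX' sY' sZ'] [eX eY eZ ->]]]]]].
have VVU : V `&` U `<=` U by move=> ? [].
have VUV : V `&` U `<=` V by move=> ? [].
by apply: (curvature_field_tensorial (openI oV oU)) => //;
  solve [exact: smooth_vfield_subset VVU _|exact: smooth_vfield_subset VUV _].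
Qed.

Let ext (v : tangent p) : exists2 X : vfield M, smooth_vfield U X & X p = v.
Proof. exact: (frame_extension he). Qed.

Lemma curvature_linear1 (a : R) (x x' y z : tangent p) :
  curvature nabla (a *: x + x') y z = a *: curvature nabla x y z + curvature nabla x' y z.
Proof.
have [X sX <-] := ext x; have [X' sX' <-] := ext x'.
have [Y sY <-] := ext y; have [Z sZ <-] := ext z.
have sa := smooth_on_cst U a.
rewrite (curvatureE (X := fun q => a *: X q + X' q))//; last exact: smooth_vfield_axpy.
by rewrite !curvatureE// (curvature_field_linearl hnabla oU sa).
Qed.

Lemma curvature_linear3 (a : R) (x y z z' : tangent p) :
  curvature nabla x y (a *: z + z') = a *: curvature nabla x y z + curvature nabla x y z'.
Proof.
have [X sX <-] := ext x; have [Y sY <-] := ext y.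
have [Z sZ <-] := ext z; have [Z' sZ' <-] := ext z'.
have sa := smooth_on_cst U a.
rewrite (curvatureE (Z := fun q => a *: Z q + Z' q))//; last exact: smooth_vfield_axpy.
by rewrite !curvatureE// (curvature_field_linearr hnabla oU sa).
Qed.

Lemma curvature_anti (x y z : tangent p) :
  curvature nabla y x z = - curvature nabla x y z.
Proof.
have [X sX <-] := ext x; have [Y sY <-] := ext y; have [Z sZ <-] := ext z.
by rewrite !curvatureE// (curvature_field_anti hnabla oU).
Qed.

Lemma curvature_linear2 (a : R) (x y y' z : tangent p) :
  curvature nabla x (a *: y + y') z = a *: curvature nabla x y z + curvature nabla x y' z.
Proof.
by rewrite ![curvature nabla x _ z]curvature_anti curvature_linear1 opprD scalerN.
Qed.

End Curvature.

(** * Skew-circulant matrices and S-invariant forms *)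

Section SkewCirculantForms.
Variable (R : realType).
Implicit Types (A B a b : R).
Local Notation K := (skew_circulant_S R).

Lemma skew_circulant_SKt : K *m K^T = 1%:M.
Proof.
apply/matrixP => i j; rewrite !mxE !big_ord_recl big_ord0 !mxE.
by case: i => [[|[|[|[|//]]]] ?]; case: j => [[|[|[|[|//]]]] ?] /=; ring.
Qed.

Lemma tr_skew_circulant_g a b : (skew_circulant_g a b)^T = skew_circulant_g a b.
Proof.
apply/matrixP => i j; rewrite !mxE.
by case: i => [[|[|[|[|//]]]] ?]; case: j => [[|[|[|[|//]]]] ?].
Qed.

Lemma mxtrace_skew_circulant_gM A B a b :
  \tr (skew_circulant_g A B *m skew_circulant_g a b) = 4 * (A * a + 2 * B * b).
Proof.
rewrite /mxtrace !big_ord_recl big_ord0 !mxE !big_ord_recl !big_ord0 !mxE /=; ring.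
Qed.

(** The coefficients solve s A + 2 t B = a and s B + t A = b, a system with
    determinant A^2 - 2 B^2. *)
Lemma skew_circulant_g_span A B a b : skew_circulant_det A B != 0 ->
  exists s t, skew_circulant_g a b =
    s *: skew_circulant_g A B + t *: skew_circulant_g (2 * B) A.
Proof.
move=> D0; exists ((a * A - 2 * b * B) / skew_circulant_det A B),
  ((b * A - a * B) / skew_circulant_det A B).
apply: (scalerI D0); rewrite scalerDr !scalerA ![_ * (_ / _)]mulrC !divfK//.
apply/matrixP => i j; rewrite !mxE /skew_circulant_det.
by case: i => [[|[|[|[|//]]]] ?]; case: j => [[|[|[|[|//]]]] ?] /=; ring.
Qed.

(** With A, B the coefficients of g this is the Gram matrix of the associated
    metric. *)
Lemma skew_circulant_gDtr A B :
  skew_circulant_g A B *m K^T + K *m skew_circulant_g A B = skew_circulant_g (2 * B) A.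
Proof.
apply/matrixP => i j; rewrite !mxE !big_ord_recl !big_ord0 !mxE.
by case: i => [[|[|[|[|//]]]] ?]; case: j => [[|[|[|[|//]]]] ?] /=; ring.
Qed.

Lemma skew_circulant_gM_inv A B : skew_circulant_det A B != 0 ->
  skew_circulant_g A B *m
    ((skew_circulant_det A B)^-1 *: skew_circulant_g A (- B)) = 1%:M.
Proof. by move=> D0; rewrite -scalemxAr skew_circulant_gM scale_scalar_mx mulVf. Qed.

Lemma invmx_skew_circulant_g A B : skew_circulant_det A B != 0 ->
  invmx (skew_circulant_g A B) = (skew_circulant_det A B)^-1 *: skew_circulant_g A (- B).
Proof.
move=> /skew_circulant_gM_inv E.
by have [u _] := mulmx1_unit E; rewrite -[LHS]mulmx1 -E mulKmx.
Qed.

(** Writing a matrix by its entries lets the products with K reduce by computation. *)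
Lemma matrix4_rowsE (P : 'M[R]_4) : exists p : nat -> nat -> R,
  P = matrix4_of_rows [seq [seq p i j | j <- iota 0 4] | i <- iota 0 4].
Proof.
exists (fun i j => P (inord i) (inord j)); apply/matrixP => i j; rewrite mxE.
rewrite (nth_map 0%N) ?size_iota// nth_iota// (nth_map 0%N) ?size_iota// nth_iota//.
by rewrite !add0n !inord_val.
Qed.

(** Commutation with K makes the entries constant along diagonals, with a sign
    change at the border. This makes the entries at distance two antisymmetric, so
    they vanish in P + P^T, and it identifies the remaining entries with the first
    two of the first row. *)
Lemma sym_invariant_skew_circulant_g (P : 'M[R]_4) : K *m P = P *m K ->
  exists a b, P + P^T = skew_circulant_g a b.
Proof.
have [p ->] := matrix4_rowsE P => /matrixP PK; exists (2 * p 0 0), (p 0 1 + p 1 0).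
have E i j (i4 : (i < 4)%N) (j4 : (j < 4)%N) := PK (Ordinal i4) (Ordinal j4).
have shift i j : (i < 3)%N -> (j < 3)%N -> p i.+1 j.+1 = p i j.
  case: i => [|[|[|//]]] _; case: j => [|[|[|//]]] _;
  [move: (E 0 1 isT isT)%N|move: (E 0 2 isT isT)%N|move: (E 0 3 isT isT)%N
  |move: (E 1 1 isT isT)%N|move: (E 1 2 isT isT)%N|move: (E 1 3 isT isT)%N
  |move: (E 2 1 isT isT)%N|move: (E 2 2 isT isT)%N|move: (E 2 3 isT isT)%N];
  by rewrite !mxE !big_ord_recl !big_ord0 !mxE /= !(mul1r, mulr1, mul0r, mulr0, add0r, addr0).
have wrap i : (i < 3)%N -> p i.+1 0%N = - p i 3%N.
  case: i => [|[|[|//]]] _;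
  [move: (E 0 0 isT isT)%N|move: (E 1 0 isT isT)%N|move: (E 2 0 isT isT)%N];
  by rewrite !mxE !big_ord_recl !big_ord0 !mxE /=
       !(mulrN, mul1r, mulr1, mul0r, mulr0, add0r, addr0).
apply/matrixP => i j; rewrite !mxE.
by case: i => [[|[|[|[|//]]]] ?]; case: j => [[|[|[|[|//]]]] ?];
  rewrite /= ?shift// ?wrap// ?shift//; ring.
Qed.

End SkewCirculantForms.

(** * Contractions in a basis *)

Section Contraction.
Variables (R : realType) (M : manifold4 R) (p : M) (b : 'I_4 -> tangent p).
Implicit Types (h k : tangent p -> tangent p -> R).

(** The common pattern of the Ricci tensor and of
    the two scalar curvatures. *)
Definition contraction h k : R := \sum_i \sum_j invmx (gram h b) i j * k (b i) (b j).

Lemma contractionE h k : contraction h k = \tr (invmx (gram h b) *m (gram k b)^T).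
Proof.
by apply: eq_bigr => i _; rewrite mxE; apply: eq_bigr => j _; rewrite !mxE.
Qed.

Lemma eq_contraction h k k' : (forall x y, k x y = k' x y) ->
  contraction h k = contraction h k'.
Proof. by move=> kk; apply: eq_bigr => i _; apply: eq_bigr => j _; rewrite kk. Qed.

Lemma contractionD h k k' :
  contraction h (fun x y => k x y + k' x y) = contraction h k + contraction h k'.
Proof.
rewrite -big_split; apply: eq_bigr => i _ /=; rewrite -big_split.
by apply: eq_bigr => j _ /=; rewrite mulrDr.
Qed.

Lemma contractionZ h a k : contraction h (fun x y => a * k x y) = a * contraction h k.
Proof.
rewrite mulr_sumr; apply: eq_bigr => i _; rewrite mulr_sumr.
by apply: eq_bigr => j _; rewrite mulrCA.
Qed.

Lemma contraction_flip h k : (forall x y, h x y = h y x) ->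
  contraction h (fun x y => k y x) = contraction h k.
Proof.
move=> hs; rewrite /contraction exchange_big; apply: eq_bigr => i _.
apply: eq_bigr => j _; congr (_ * _).
rewrite -[in LHS](_ : (gram h b)^T = gram h b) -?trmx_inv ?mxE//.
by apply/matrixP => i' j'; rewrite !mxE hs.
Qed.

Lemma bilinear_form_comb h (C : 'M[R]_4) : bilinear_form h ->
  gram h (fun i => \sum_k C i k *: b k) = C *m gram h b *m C^T.
Proof.
move=> hh; apply/matrixP => i j; rewrite !mxE (form_sumr hh).
apply: eq_bigr => l _; rewrite (formZr hh) (form_suml hh) !mxE mulrC; congr (_ * _).
by apply: eq_bigr => k _; rewrite (formZl hh) mxE.
Qed.

Lemma bilinear_form_gram_inj h k : is_basis b -> bilinear_form h -> bilinear_form k ->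
  gram h b = gram k b -> forall x y, h x y = k x y.
Proof.
move=> [_ span] hh kh /matrixP hk x y; have [c ->] := span x; have [d ->] := span y.
rewrite (form_suml hh) (form_suml kh); apply: eq_bigr => i _.
rewrite (formZl hh) (formZl kh) (form_sumr hh) (form_sumr kh); congr (_ * _).
apply: eq_bigr => j _; rewrite (formZr hh) (formZr kh).
by have := hk i j; rewrite !mxE => ->.
Qed.

End Contraction.

(** * S-invariant forms in an adapted frame *)

Section SkewCirculantPoint.
Variables (R : realType) (M : manifold4 R) (g : riemannian_metric M)
  (S : tensor11 M) (U : set M) (e : 'I_4 -> vfield M) (p : M).
Hypothesis S_iso : forall x y : tangent p, g p (S p x) (S p y) = g p x y.
Hypothesis he : adapted_frame g S U e.
Hypothesis Up : U p.
Implicit Types (x y z : tangent p) (h k : tangent p -> tangent p -> R).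
Local Notation b := (fun i => e i p).
Local Notation K := (skew_circulant_S R).
Local Notation gt := (@associated_metric R M g S p).
Let gb := metric_bilinear g p.

Lemma associated_metric_bilinear : bilinear_form gt.
Proof.
by split=> a x y z; rewrite /associated_metric linearP ?(gb.1, gb.2); ring.
Qed.

Lemma gram_frame_metric : exists A B, 0 < skew_circulant_det A B /\
  gram (@g p) b = skew_circulant_g A B.
Proof.
have [A [B [_ _ /(_ p Up)[GE AB]]]] := frame_g he.
by exists (A p), (B p); split => //; exact: skew_circulant_det_gt0.
Qed.

Lemma gram_S h : bilinear_form h ->
  gram (fun x y => h (S p x) (S p y)) b = K *m gram h b *m K^T.
Proof.
move=> hh; rewrite -bilinear_form_comb//; apply/matrixP => i j.
by rewrite !mxE !(frame_S he Up).
Qed.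

Lemma gram_associated_metric : gram gt b = gram (@g p) b *m K^T + K *m gram (@g p) b.
Proof.
apply/matrixP => i j; rewrite !mxE /associated_metric !(frame_S he Up).
rewrite (form_sumr gb) (form_suml gb); congr (_ + _); apply: eq_bigr => k _.
  by rewrite (formZr gb) !mxE mulrC.
by rewrite (formZl gb) !mxE.
Qed.

Lemma gram_S_comm h : bilinear_form h ->
  (forall x y, h (S p x) (S p y) = h x y) -> K *m gram h b = gram h b *m K.
Proof.
move=> hh hS; have := gram_S hh.
rewrite (_ : gram (fun x y => h (S p x) (S p y)) b = gram h b); last first.
  by apply/matrixP => i j; rewrite !mxE.
by move=> {2}->; rewrite -mulmxA (mulmx1C (skew_circulant_SKt R)) mulmx1.
Qed.

(** The frame S e is another basis with the same Gram matrix as e. In matrices: K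
    is orthogonal and commutes with the Gram matrix of g, hence with its inverse. *)
Lemma contraction_S k : bilinear_form k ->
  contraction b (@g p) (fun x y => k (S p x) (S p y)) = contraction b (@g p) k.
Proof.
move=> kh; rewrite !contractionE gram_S//.
have [A [B [D0 GE]]] := gram_frame_metric.
have Gu : gram (@g p) b \in unitmx.
  have /mulmx1_unit[] // : gram (@g p) b *m
      ((skew_circulant_det A B)^-1 *: skew_circulant_g A (- B)) = 1%:M.
  by rewrite GE skew_circulant_gM_inv// gt_eqF.
have KN : K *m invmx (gram (@g p) b) = invmx (gram (@g p) b) *m K.
  rewrite -[LHS](mulKmx Gu); congr (_ *m _).
  by rewrite mulmxA -gram_S_comm// -mulmxA mulmxV// mulmx1.
rewrite !trmx_mul trmxK !mulmxA -KN mxtrace_mulC !mulmxA.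
by rewrite (mulmx1C (skew_circulant_SKt R)) mul1mx.
Qed.

(** Both sides are bilinear, and their Gram matrices agree because those of g and
    g~ span the matrices of the shape that the left-hand side must have. *)
Lemma invariant_form_sym h : bilinear_form h ->
  (forall x y, h (S p x) (S p y) = h x y) ->
  exists s t, forall x y, h x y + h y x = s * g p x y + t * gt x y.
Proof.
move=> hh hS; have [A [B [D0 GE]]] := gram_frame_metric.
have [a [c Q]] := sym_invariant_skew_circulant_g (gram_S_comm hh hS).
have [|s [t st]] := @skew_circulant_g_span _ A B a c; first by rewrite gt_eqF.
exists s, t; apply: (bilinear_form_gram_inj (frame_basis he Up)).
- by split=> a' x y z; rewrite hh.1 hh.2; ring.
- have tb := associated_metric_bilinear.
  by split=> a' x y z; rewrite ?(gb.1, gb.2) ?(tb.1, tb.2); ring.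
have -> : gram (fun x y => h x y + h y x) b = gram h b + (gram h b)^T.
  by apply/matrixP => i j; rewrite !mxE.
rewrite Q st -skew_circulant_gDtr -GE -gram_associated_metric.
by apply/matrixP => i j; rewrite !mxE.
Qed.

Lemma contraction_skew_circulant_g h k A B a c : skew_circulant_det A B != 0 ->
  gram h b = skew_circulant_g A B -> gram k b = skew_circulant_g a c ->
  contraction b h k = 4 * (A * a - 2 * B * c) / skew_circulant_det A B.
Proof.
move=> D0 hE kE; rewrite contractionE hE kE tr_skew_circulant_g.
rewrite invmx_skew_circulant_g// -scalemxAl mxtraceZ mxtrace_skew_circulant_gM.
by rewrite mulrN mulNr mulrC.
Qed.

(** With K the matrix of S, the mixed traces are multiples of the trace of
    K + K^-1, which is zero. *)
Lemma metric_contractions : [/\ contraction b (@g p) (@g p) = 4,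
  contraction b (@g p) gt = 0, contraction b gt (@g p) = 0 & contraction b gt gt = 4].
Proof.
have [A [B [D0 GE]]] := gram_frame_metric.
have tE := gram_associated_metric; rewrite GE skew_circulant_gDtr in tE.
have Dt : skew_circulant_det (2 * B) A = - 2 * skew_circulant_det A B.
  by rewrite /skew_circulant_det; ring.
have n0 : skew_circulant_det A B != 0 by rewrite gt_eqF.
have tn0 : skew_circulant_det (2 * B) A != 0 by rewrite Dt mulf_neq0// oppr_eq0 pnatr_eq0.
split.
- rewrite (contraction_skew_circulant_g n0 GE GE); apply: (mulIf n0).
  by rewrite divfK// /skew_circulant_det; ring.
- rewrite (contraction_skew_circulant_g n0 GE tE); apply: (mulIf n0).
  by rewrite divfK//; ring.
- rewrite (contraction_skew_circulant_g tn0 tE GE); apply: (mulIf tn0).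
  by rewrite divfK//; ring.
- rewrite (contraction_skew_circulant_g tn0 tE tE); apply: (mulIf tn0).
  by rewrite divfK// /skew_circulant_det; ring.
Qed.

(** Contracting s g + t g~ with g and with g~ recovers s and t. *)
Lemma contractions_invariant_form h : bilinear_form h ->
  (forall x y, h (S p x) (S p y) = h x y) ->
  forall x, h x x = contraction b (@g p) h / 4 * g p x x
                    + contraction b gt h / 2 * g p x (S p x).
Proof.
move=> hh hS x; have [s [t st]] := invariant_form_sym hh hS.
have [gg gt0 tg tt] := metric_contractions.
have gs u v : gt u v = gt v u.
  by rewrite /associated_metric addrC !(riemannian_sym g (S p _)).
have two k : (forall u v, k u v = k v u) ->
    2 * contraction b k h = s * contraction b k (@g p) + t * contraction b k gt.
  move=> ks; rewrite -(contractionZ _ _ s) -(contractionZ _ _ t) -contractionD.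
  rewrite -(eq_contraction b k st).
  rewrite contractionD contraction_flip//; ring.
have e1 := two (@g p) (@riemannian_sym _ _ g p); rewrite gg gt0 in e1.
have e2 := two gt gs; rewrite tg tt in e2.
have e3 := st x x; rewrite [gt x x]/associated_metric (riemannian_sym g (S p x)) in e3.
have -> : contraction b (@g p) h = 2 * s by lra.
have -> : contraction b gt h = 2 * t by lra.
lra.
Qed.

(** Positivity of g on x + Sx and on x - Sx: the case of the Cauchy-Schwarz
    inequality that puts the cosine in the domain of [acos]. *)
Lemma abs_metric_S_le x : `|g p x (S p x)| <= g p x x.
Proof.
have pos y : 0 <= g p y y.
  by have [->|/riemannian_pos/ltW//] := eqVneq y 0; rewrite (form0l gb).
have := pos (x + S p x); have := pos (x + (-1) *: S p x).
rewrite !(formDl gb, formDr gb, formZl gb, formZr gb) S_iso (riemannian_sym g (S p x)).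
by rewrite ler_norml => ? ?; apply/andP; split; lra.
Qed.

Lemma cos_angle_S x : g p x x != 0 -> cos (angle g x (S p x)) = g p x (S p x) / g p x x.
Proof.
move=> x0; have le := abs_metric_S_le x; have ge0 := le_trans (normr_ge0 _) le.
have gt0 : 0 < g p x x by rewrite lt0r x0.
rewrite /angle S_iso -expr2 sqr_sqrtr// acosK// in_itv /= -ler_norml.
by rewrite normrM normfV (gtr0_norm gt0) ler_pdivrMr// mul1r.
Qed.

End SkewCirculantPoint.

(** * The Ricci tensor *)

Section Ricci.
Variables (R : realType) (M : manifold4 R) (g : riemannian_metric M)
  (S : tensor11 M) (nabla : vfield M -> vfield M -> vfield M)
  (U : set M) (e : 'I_4 -> vfield M) (p : M).
Hypothesis S_iso : forall x y : tangent p, g p (S p x) (S p y) = g p x y.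
Hypothesis hnabla : levi_civita g nabla.
Hypothesis he : adapted_frame g S U e.
Hypothesis Up : U p.
Hypothesis R_S : forall x y z u : tangent p,
  curvature4 g nabla (S p x) (S p y) (S p z) (S p u) = curvature4 g nabla x y z u.
Implicit Types (x y z : tangent p).
Local Notation b := (fun i => e i p).
Let gb := metric_bilinear g p.

Lemma curvature4_bilinear_outer y z :
  bilinear_form (fun u v : tangent p => curvature4 g nabla u y z v).
Proof.
split=> a u v w; rewrite /curvature4 ?gb.2// (curvature_linear1 hnabla he Up).
exact: gb.1.
Qed.

Lemma ricciE y z :
  ricci g nabla b y z = contraction b (@g p) (fun u v => curvature4 g nabla u y z v).
Proof. by []. Qed.

Lemma ricci_bilinear : bilinear_form (ricci g nabla b).
Proof.
split=> a x y z; rewrite !ricciE -contractionZ -contractionD;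
  apply: eq_contraction => u v; rewrite /curvature4.
  by rewrite (curvature_linear2 hnabla he Up) gb.1.
by rewrite (curvature_linear3 hnabla he Up) gb.1.
Qed.

(** Apply the invariance of R to all four arguments after moving the contracted
    basis from e to S e. *)
Lemma ricci_S x y : ricci g nabla b (S p x) (S p y) = ricci g nabla b x y.
Proof.
have E := contraction_S S_iso he Up (curvature4_bilinear_outer (S p x) (S p y)).
rewrite !ricciE -E; apply: eq_contraction => u v; exact: R_S.
Qed.

Lemma ricci_direction_S x : ricci_direction g nabla b (S p x) = ricci_direction g nabla b x.
Proof. by rewrite /ricci_direction ricci_S S_iso. Qed.

End Ricci.

Theorem theorem3p5 (R : realType) (M : manifold4 R) (g : riemannian_metric M)
    (S : tensor11 M) (nabla : vfield M -> vfield M -> vfield M)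
    (hM : skew_circulant_manifold g S)
    (hnabla : levi_civita g nabla)
    (hR : forall (q : M) (x y z u : tangent q),
      curvature4 g nabla (S q x) (S q y) (S q z) (S q u)
      = curvature4 g nabla x y z u)
    (p : M) (U : set M) (e : 'I_4 -> vfield M)
    (hp : U p) (he : adapted_frame g S U e)
    (x : tangent p) (hx : induces_S_basis S x) :
  let ep := fun i => e i p in
  let r := ricci_direction g nabla ep in
  let tau := scalar_curvature g nabla ep in
  let tau_star := scalar_curvature_star g S nabla ep in
  let phi := angle g x (S p x) in
  [/\ r x = r (S p x),
      r (S p x) = r (S p (S p x)),
      r (S p (S p x)) = r (S p (S p (S p x))) &
      r (S p (S p (S p x))) = tau / 4 + tau_star / 2 * cos phi].
Proof.
move=> ep r tau tau_star phi; have S_iso := @S_isometry _ _ _ _ hM p.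
have rS y : r (S p y) = r y := ricci_direction_S S_iso hnabla he hp (hR p) y.
split; rewrite ?rS//.
(* x is the last vector, of index 3, in the S-basis S^3 x, S^2 x, S x, x. *)
have x0 : x != 0.
  apply/eqP => x0; have [/(_ (fun i => (i == 3)%:R))] := hx.
  rewrite big1 => [/(_ erefl 3)/eqP|i _]; first by rewrite eqxx oner_eq0.
  have [->|] := eqVneq i 3; last by rewrite scale0r.
  by rewrite x0 scaler0.
have g0 : g p x x != 0 by rewrite gt_eqF// riemannian_pos.
rewrite /r /ricci_direction /phi (cos_angle_S S_iso)//.
rewrite (contractions_invariant_form he hp (ricci_bilinear hnabla he hp)
  (ricci_S S_iso hnabla he hp (hR p))).
by rewrite mulrDl mulfK// mulrA.
Qed.
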